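(* Let $\epsilon>0$ and $A\ge 0$. There exists $n_0\ge 0$ such that for every composition $\lambda$ of size $n\ge n_0$ whose first run and last run both have length at most $A$, $$\sup_{(x,y)\in[0,1]^2}\big|d_{X_I,X_F}(x,y)-d_{X_I}(x)\,d_{X_F}(y)\big|<\epsilon,$$ where $d_{X_I,X_F}$ is the joint density of $(X_I,X_F)$ and $d_{X_I},d_{X_F}$ are the marginal densities, in the continuous model associated with $\lambda$.
   Context: A composition $\lambda$ of $n$ is a finite sequence of positive integers $(\lambda_1,\dots,\lambda_k)$ with $\sum_j\lambda_j=n$; its descent set is $D_\lambda=\{\lambda_1,\lambda_1+\lambda_2,\dots,\lambda_1+\dots+\lambda_{k-1}\}\subseteq\{1,\dots,n-1\}$. The continuous model associated with $\lambda$: let $P_\lambda=\{x\in[0,1]^n:\ x_i\ge x_{i+1}\text{ if }i\in D_\lambda,\ x_i\le x_{i+1}\text{ if }i\notin D_\lambda,\ 1\le i\le n-1\}$ and let $(x_1,\dots,x_n)$ be uniformly distributed on $P_\lambda$ (equivalently, independent uniform variables on $[0,1]$ conditioned on having the descent pattern $D_\lambda$); set $X_I=x_1$, $X_F=x_n$. A run of $\lambda$ is a maximal set of consecutive cells $\{a,a+1,\dots,b\}$ with $b\ge a+1$ such that either $\{a,\dots,b-1\}\cap D_\lambda=\emptyset$ or $\{a,\dots,b-1\}\subseteq D_\lambda$; its length is $b-a+1$. The first run is the run containing cell $1$, the last run the one containing cell $n$. (Via the correspondence $\sigma(i)=$ rank of $x_i$ among $x_1,\dots,x_n$, which gives the uniform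 permutation with descent set $D_\lambda$, this is equivalent to asymptotic independence of $\sigma_\lambda(1)/n$ and $\sigma_\lambda(n)/n$.) *)

(* Defs.v *)
From Stdlib Require Import Reals Lra List Classical ClassicalEpsilon.
Import ListNotations.
Open Scope R_scope.

(** Total Riemann integral on [a,b]: the Riemann integral when f is Riemann
    integrable on [a,b] (independent of the chosen proof, RiemannInt_P5),
    and 0 otherwise. *)
Definition Rint (f : R -> R) (a b : R) : R :=
  match excluded_middle_informative (inhabited (Riemann_integrable f a b)) with
  | left H => RiemannInt (epsilon H (fun _ => True))
  | right _ => 0
  end.

Definition is_composition (lam : list nat) : Prop :=
  Forall (fun k => (0 < k)%nat) lam.

Fixpoint psums (acc : nat) (l : list nat) : list nat :=
  match l with
  | [] => []
  | [_] => []
  | a :: l' => (acc + a)%nat :: psums (acc + a)%nat l'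
  end.

Definition descent_set (lam : list nat) : list nat := psums 0 lam.

Definition isDesc (lam : list nat) (i : nat) : bool :=
  existsb (Nat.eqb i) (descent_set lam).

Definition pattern (lam : list nat) : list bool :=
  map (isDesc lam) (seq 1 (list_sum lam - 1)).

Fixpoint lead_len (b : bool) (l : list bool) : nat :=
  match l with
  | [] => 0
  | c :: l' => if Bool.eqb b c then S (lead_len b l') else 0
  end.

Definition prefix_const_len (l : list bool) : nat :=
  match l with [] => 0 | b :: _ => lead_len b l end.

(** Length of the first run (the run containing cell 1) and of the last run
    (the run containing cell n), for n >= 2. *)
Definition first_run_len (lam : list nat) : nat :=
  S (prefix_const_len (pattern lam)).
Definition last_run_len (lam : list nat) : nat :=
  S (prefix_const_len (rev (pattern lam))).

(** Constraint between x_i (=s) and x_{i+1} (=t). *)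
Definition constr (lam : list nat) (i : nat) (s t : R) : R :=
  if isDesc lam i then (if Rle_dec t s then 1 else 0)
  else (if Rle_dec s t then 1 else 0).

(** kern lam m x t = (n-2... ) : the (m-1)-dimensional volume of
    {(x_2..x_m) in [0,1]^(m-1) : constraints 1..m hold with x_1 = x, x_{m+1} = t}. *)
Fixpoint kern (lam : list nat) (m : nat) (x t : R) : R :=
  match m with
  | O => 0
  | S O => constr lam 1 x t
  | S m' => Rint (fun s => kern lam m' x s * constr lam m s t) 0 1
  end.

Definition comp_size (lam : list nat) : nat := list_sum lam.

Definition volP (lam : list nat) : R :=
  Rint (fun x => Rint (fun y => kern lam (comp_size lam - 1) x y) 0 1) 0 1.

(** Joint density of (X_I, X_F) = (x_1, x_n) under the uniform law on P_lam. *)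
Definition dIF (lam : list nat) (x y : R) : R :=
  kern lam (comp_size lam - 1) x y / volP lam.

Definition dI (lam : list nat) (x : R) : R := Rint (fun y => dIF lam x y) 0 1.
Definition dF (lam : list nat) (y : R) : R := Rint (fun x => dIF lam x y) 0 1.

(* Main.v *)
(** Integrating out one coordinate at a time makes the joint density of [(x_1, x_t)]
    evolve by the positive operators [f |-> int_0^t f] (ascent) and [f |-> int_t^1 f]
    (descent). If [f] is nonincreasing, [b] ascents turn it into a function [H] with
    [t^b H(1) <= H(t) <= t^(b-1) H(1)], so a further descent makes it proportional to
    [1 - t^b] up to a factor [b / (b + 1)]. Hence an interior run with [b] steps makes
    the rows of the kernel proportional up to [(b / (b + 1))^2]: this is at least [1/4]
    for any run, which by Birkhoff's contraction argument gives [1 - (3/4)^r] after [r]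
    disjoint runs, and it tends to [1] with [b]. A large [n] forces either many runs or a
    long interior one. Short first and last runs bound the marginal densities, which
    converts this multiplicative estimate into an additive one. *)

Require Import Defs.
From Stdlib Require Import Reals List Lra Lia Psatz Bool Classical ClassicalEpsilon.
From Coquelicot Require Import Coquelicot.
Import ListNotations.
Open Scope R_scope.

Implicit Types f g : R -> R.
Implicit Types w : list bool.

(** * Positive integration operators on [[0,1]] *)

(** The bound makes [T c f] Lipschitz, so integrability propagates along a word even when it starts
    from the discontinuous step functions [st]. *)
Definition good (f : R -> R) : Prop :=
  (exists M, forall t, 0 <= t <= 1 -> 0 <= f t <= M) /\ ex_RInt f 0 1.

Definition T (c : bool) (f : R -> R) (t : R) : R :=
  if c then RInt f t 1 else RInt f 0 t.

Definition Tw (w : list bool) (f : R -> R) : R -> R :=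
  fold_left (fun g c => T c g) w f.

Definition st (c : bool) (s t : R) : R :=
  if c then (if Rle_dec t s then 1 else 0) else (if Rle_dec s t then 1 else 0).

(** Unnormalised density of the last coordinate when the first one is [x]. The first letter only
    creates a step function; each later letter costs one integration. The empty word gets the value
    [0], as [kern] does at [0], so the concatenation law asks for a nonempty left factor. *)
Definition K (w : list bool) (x : R) : R -> R :=
  match w with [] => fun _ => 0 | c :: w' => Tw w' (st c x) end.

Lemma good_nonneg f t : good f -> 0 <= t <= 1 -> 0 <= f t.
Proof. intros [[M HM] _]; apply HM. Qed.

Lemma ex_RInt_sub f a b : ex_RInt f 0 1 -> 0 <= a <= b -> b <= 1 -> ex_RInt f a b.
Proof.
  intros H Ha Hb.
  apply (ex_RInt_Chasles_1 f a b 1); [lra|].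
  apply (ex_RInt_Chasles_2 f 0 a 1); [lra|exact H].
Qed.

Lemma good_ex f a b : good f -> 0 <= a <= b -> b <= 1 -> ex_RInt f a b.
Proof. intros [_ H]; apply ex_RInt_sub, H. Qed.

Lemma lipschitz_ex_RInt f M :
  (forall s t, 0 <= s <= t -> t <= 1 -> Rabs (f t - f s) <= M * (t - s)) ->
  ex_RInt f 0 1.
Proof.
  intros H.
  assert (HM : 0 <= M).
  { generalize (H 0 1 ltac:(lra) ltac:(lra)) (Rabs_pos (f 1 - f 0)). lra. }
  (* Composing with the projection onto [[0,1]] gives a function that is continuous on the whole
     line and agrees with [f] on the interval. *)
  pose (clamp := fun z => Rmax 0 (Rmin 1 z)).
  assert (Hc : forall z, 0 <= clamp z <= 1).
  { intros z; unfold clamp, Rmax, Rmin. destruct (Rle_dec 1 z); destruct (Rle_dec 0 _); lra. }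
  assert (Hl : forall y z, Rabs (clamp y - clamp z) <= Rabs (y - z)).
  { intros y z; unfold clamp, Rmax, Rmin.
    destruct (Rle_dec 1 z), (Rle_dec 1 y); repeat destruct (Rle_dec 0 _);
    unfold Rabs; repeat destruct (Rcase_abs _); lra. }
  assert (Hf : forall y z, Rabs (f (clamp y) - f (clamp z)) <= M * Rabs (y - z)).
  { intros y z. apply Rle_trans with (M * Rabs (clamp y - clamp z)).
    2:{ apply Rmult_le_compat_l; auto. }
    destruct (Rle_dec (clamp z) (clamp y)) as [L|L].
    - rewrite (Rabs_pos_eq (clamp y - _)) by lra. apply H; generalize (Hc y) (Hc z); lra.
    - rewrite Rabs_minus_sym, (Rabs_minus_sym (clamp y)).
      rewrite (Rabs_pos_eq (clamp z - _)) by lra. apply H; generalize (Hc y) (Hc z); lra. }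
  apply ex_RInt_ext with (fun z => f (clamp z)).
  { intros x. rewrite Rmin_left, Rmax_right by lra. intros Hx. f_equal.
    unfold clamp, Rmax, Rmin. destruct (Rle_dec 1 x); destruct (Rle_dec 0 _); lra. }
  apply (ex_RInt_continuous (V:=R_CompleteNormedModule)). intros z _.
  apply continuity_pt_filterlim.
  (* [M] may be [0], hence the denominator [M + 1]. *)
  intros e He. exists (e / (M + 1)). split.
  { apply Rdiv_lt_0_compat; lra. }
  intros y [_ Hy]. unfold dist in *; simpl in *; unfold R_dist in *.
  apply Rle_lt_trans with (1 := Hf y z).
  apply Rle_lt_trans with ((M + 1) * Rabs (y - z)).
  { generalize (Rabs_pos (y - z)); nra. }
  apply Rlt_le_trans with ((M + 1) * (e / (M + 1))).
  { apply Rmult_lt_compat_l; lra. }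
  right; field; lra.
Qed.

Lemma RInt_nonneg f a b : good f -> 0 <= a <= b -> b <= 1 -> 0 <= RInt f a b.
Proof.
  intros G Ha Hb. apply RInt_ge_0; [lra|apply good_ex; auto|].
  intros x Hx. apply good_nonneg; auto; lra.
Qed.

Lemma RInt_cst (m a b : R) : RInt (fun _ => m) a b = m * (b - a).
Proof. rewrite (RInt_const (V:=R_CompleteNormedModule)). apply Rmult_comm. Qed.

Lemma RInt_bound f a b M :
  good f -> 0 <= a <= b -> b <= 1 -> (forall t, 0 <= t <= 1 -> f t <= M) ->
  RInt f a b <= M * (b - a).
Proof.
  intros G Ha Hb HM.
  rewrite <- RInt_cst.
  apply RInt_le; [lra|apply good_ex; auto|apply ex_RInt_const|].
  intros; apply HM; lra.
Qed.

Lemma RInt_split f (a b c : R) :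
  good f -> 0 <= a <= b -> b <= c <= 1 -> RInt f a c = RInt f a b + RInt f b c.
Proof.
  intros G Ha Hc. symmetry.
  apply (RInt_Chasles (V:=R_CompleteNormedModule)); apply good_ex; auto; lra.
Qed.

Lemma T_nonneg c f t : good f -> 0 <= t <= 1 -> 0 <= T c f t.
Proof. intros; destruct c; apply RInt_nonneg; auto; lra. Qed.

(* [true] stands for a descent, hence for a nonincreasing function. *)
Definition monotone (c : bool) (f : R -> R) : Prop :=
  forall s t, 0 <= s <= t -> t <= 1 ->
  if c return Prop then f t <= f s else f s <= f t.

Lemma T_le_RInt c f t : good f -> 0 <= t <= 1 -> T c f t <= RInt f 0 1.
Proof.
  intros G Ht. rewrite (RInt_split f 0 t 1) by (auto; lra).
  generalize (RInt_nonneg f 0 t G) (RInt_nonneg f t 1 G). destruct c; simpl; lra.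
Qed.

Lemma T_good c f : good f -> good (T c f).
Proof.
  intros G. destruct (proj1 G) as [M HM]. split.
  - exists (RInt f 0 1). intros t Ht. split; [now apply T_nonneg|now apply T_le_RInt].
  - apply lipschitz_ex_RInt with M. intros s t Hs Ht.
    assert (E : Rabs (T c f t - T c f s) = RInt f s t).
    { generalize (RInt_nonneg f s t G Hs Ht). intros Hp. destruct c; simpl.
      - rewrite (RInt_split f s t 1) by (auto; lra).
        unfold Rabs; destruct (Rcase_abs _); lra.
      - rewrite (RInt_split f 0 s t) by (auto; lra).
        unfold Rabs; destruct (Rcase_abs _); lra. }
    rewrite E. apply RInt_bound; auto. intros; now apply HM.
Qed.

Lemma T_monotone c f : good f -> monotone c (T c f).
Proof.
  intros G s t Hs Ht. destruct c; simpl.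
  - rewrite (RInt_split f s t 1) by (auto; lra). generalize (RInt_nonneg f s t G); lra.
  - rewrite (RInt_split f 0 s t) by (auto; lra). generalize (RInt_nonneg f s t G); lra.
Qed.

Lemma T_le c f g t :
  good f -> good g -> (forall s, 0 <= s <= 1 -> f s <= g s) -> 0 <= t <= 1 ->
  T c f t <= T c g t.
Proof.
  intros Gf Gg H Ht. destruct c; simpl; apply RInt_le; try lra;
  try (apply good_ex; auto; lra); intros; apply H; lra.
Qed.

Lemma T_ext c f g t :
  (forall s, 0 <= s <= 1 -> f s = g s) -> 0 <= t <= 1 -> T c f t = T c g t.
Proof.
  intros H Ht. destruct c; simpl; apply RInt_ext;
    rewrite Rmin_left, Rmax_right by lra; intros; apply H; lra.
Qed.

Lemma RInt_lin f g p q a b :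
  ex_RInt f a b -> ex_RInt g a b ->
  RInt (fun s => p * f s + q * g s) a b = p * RInt f a b + q * RInt g a b.
Proof.
  intros Hf Hg.
  apply is_RInt_unique.
  apply (is_RInt_plus (V:=R_NormedModule));
  apply (is_RInt_scal (V:=R_NormedModule)); now apply (RInt_correct (V:=R_CompleteNormedModule)).
Qed.

Lemma T_lin c f g p q t : good f -> good g -> 0 <= t <= 1 ->
  T c (fun s => p * f s + q * g s) t = p * T c f t + q * T c g t.
Proof.
  intros Gf Gg Ht.
  destruct c; simpl; apply RInt_lin; apply good_ex; auto; lra.
Qed.

Lemma good_lin f g p q : good f -> good g ->
  (forall t, 0 <= t <= 1 -> 0 <= p * f t + q * g t) ->
  good (fun s => p * f s + q * g s).
Proof.
  intros [[M HM] Hf] [[N HN] Hg] H. split.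
  - exists (Rabs p * M + Rabs q * N). intros t Ht. split; [auto|].
    apply Rplus_le_compat.
    + generalize (HM t Ht) (Rle_abs p) (Rabs_pos p). nra.
    + generalize (HN t Ht) (Rle_abs q) (Rabs_pos q). nra.
  - apply (ex_RInt_plus (V:=R_NormedModule));
    apply (ex_RInt_scal (V:=R_NormedModule)); auto.
Qed.

Lemma good_ext f g : (forall t, 0 <= t <= 1 -> f t = g t) -> good f -> good g.
Proof.
  intros H [[M HM] Hf]. split.
  - exists M. intros t Ht. rewrite <- H by auto. auto.
  - apply ex_RInt_ext with f; auto.
    rewrite Rmin_left, Rmax_right by lra. intros; apply H; lra.
Qed.

Lemma Tw_app u v f : Tw (u ++ v) f = Tw v (Tw u f).
Proof. apply fold_left_app. Qed.

Lemma Tw_good w f : good f -> good (Tw w f).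
Proof. revert f; induction w; simpl; auto. intros; apply IHw, T_good; auto. Qed.

Lemma Tw_ext w f g t :
  (forall s, 0 <= s <= 1 -> f s = g s) -> 0 <= t <= 1 -> Tw w f t = Tw w g t.
Proof.
  revert f g; induction w; simpl; auto. intros f g H Ht. apply IHw; auto.
  intros; now apply T_ext.
Qed.

Lemma Tw_lin w f g p q t : good f -> good g -> 0 <= t <= 1 ->
  Tw w (fun s => p * f s + q * g s) t = p * Tw w f t + q * Tw w g t.
Proof.
  revert f g; induction w; simpl; auto. intros f g Gf Gg Ht.
  rewrite <- IHw; auto using T_good. apply Tw_ext; auto.
  intros; now apply T_lin.
Qed.

Lemma Tw_le w f g t :
  good f -> good g -> (forall s, 0 <= s <= 1 -> f s <= g s) -> 0 <= t <= 1 ->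
  Tw w f t <= Tw w g t.
Proof.
  revert f g; induction w; simpl; auto. intros f g Gf Gg H Ht. apply IHw; auto using T_good.
  intros; apply T_le; auto.
Qed.

(** * The kernel with a fixed starting point *)

Lemma is_RInt_cst (m a b : R) f :
  (forall s, a < s < b -> f s = m) -> a <= b -> is_RInt f a b (m * (b - a)).
Proof.
  intros H Hab. rewrite Rmult_comm.
  apply (is_RInt_ext (V:=R_NormedModule)) with (fun _ => m).
  - rewrite Rmin_left, Rmax_right by lra. intros s Hs. now rewrite H.
  - apply (is_RInt_const (V:=R_NormedModule)).
Qed.

Lemma is_RInt_st c x : 0 <= x <= 1 -> is_RInt (st c x) 0 1 (if c then x else 1 - x).
Proof.
  intros Hx.
  assert (H : is_RInt (st c x) 0 1
    (plus ((if c then 1 else 0) * (x - 0)) ((if c then 0 else 1) * (1 - x)))).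
  { apply (is_RInt_Chasles (V:=R_NormedModule)) with x; apply is_RInt_cst; try lra;
    intros s Hs; unfold st; destruct c; destruct (Rle_dec _ _); lra. }
  unfold plus in H; simpl in H.
  destruct c; [replace x with (1 * (x - 0) + 0 * (1 - x)) at 2 by ring
    |replace (1 - x) with (0 * (x - 0) + 1 * (1 - x)) by ring]; exact H.
Qed.

Lemma st_good c x : 0 <= x <= 1 -> good (st c x).
Proof.
  intros Hx. split.
  - exists 1. intros t _. unfold st. destruct c; destruct (Rle_dec _ _); lra.
  - eexists; now apply is_RInt_st.
Qed.

Lemma st_monotone c x : monotone c (st c x).
Proof.
  intros s t Hs Ht. unfold st; destruct c;
  repeat destruct (Rle_dec _ _); lra.
Qed.

Lemma K_good w x : 0 <= x <= 1 -> good (K w x).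
Proof.
  intros Hx. destruct w as [|c w]; simpl.
  - split; [exists 0; intros; lra|apply ex_RInt_const].
  - now apply Tw_good, st_good.
Qed.

Lemma K_app w v x : w <> [] -> K (w ++ v) x = Tw v (K w x).
Proof. destruct w; [easy|]. intros _. simpl. apply Tw_app. Qed.

Lemma K_last_monotone w c x : 0 <= x <= 1 -> monotone c (K (w ++ [c]) x).
Proof.
  intros Hx. destruct w as [|d w].
  - apply st_monotone.
  - rewrite K_app by easy. now apply T_monotone, K_good.
Qed.

(** * Scaling of the argument *)

Lemma good_scale f t : good f -> 0 <= t <= 1 -> good (fun r => f (t * r)).
Proof.
  intros G Ht. destruct (proj1 G) as [M HM]. split.
  - exists M. intros r Hr. apply HM. nra.
  - destruct (Req_dec t 0) as [->|Ht0].
    + apply ex_RInt_ext with (fun _ => f 0); [|apply ex_RInt_const].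
      intros r _. now rewrite Rmult_0_l.
    + apply ex_RInt_ext with (fun r => / t * (t * f (t * r + 0))).
      * intros r _. simpl. rewrite Rplus_0_r, <- Rmult_assoc, Rinv_l by auto. apply Rmult_1_l.
      * apply (ex_RInt_scal (V:=R_NormedModule)).
        apply (ex_RInt_comp_lin (V:=R_NormedModule)).
        apply good_ex; auto; lra.
Qed.

Lemma RInt_scale f t (a b : R) : good f -> 0 <= t <= 1 -> 0 <= a <= b -> b <= 1 ->
  RInt f (t * a) (t * b) = t * RInt (fun r => f (t * r)) a b.
Proof.
  intros G Ht Ha Hb.
  replace (t * a) with (t * a + 0) by ring. replace (t * b) with (t * b + 0) by ring.
  rewrite <- (RInt_comp_lin (V:=R_CompleteNormedModule)).
  2:{ apply good_ex; auto; nra. }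
  rewrite <- (RInt_scal (V:=R_CompleteNormedModule)).
  - apply RInt_ext. intros. now rewrite Rplus_0_r.
  - apply (good_ex (fun r => f (t * r))); auto. now apply good_scale.
Qed.

(** Substituting [t * r] for the integration variable pulls out a factor [t]. For a descent the
    integral runs up to [1] and not just to [t]; the surplus is nonnegative, so a lower bound
    survives while the matching upper bound [T_scale_le] is confined to ascents. *)
Lemma T_scale_ge c f g t p s : good f -> good g -> 0 <= t <= 1 ->
  (forall r, 0 <= r <= 1 -> p * g r <= f (t * r)) -> 0 <= s <= 1 ->
  t * p * T c g s <= T c f (t * s).
Proof.
  intros Gf Gg Ht H Hs.
  assert (E : forall a b, 0 <= a <= b -> b <= 1 ->
    p * RInt g a b <= RInt (fun r => f (t * r)) a b).
  { intros a b Ha Hb.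
    rewrite <- (RInt_scal (V:=R_CompleteNormedModule)) by (apply good_ex; auto).
    apply RInt_le; [lra| | |].
    - apply (ex_RInt_scal (V:=R_NormedModule)), good_ex; auto.
    - apply (good_ex (fun r => f (t * r))); auto. now apply good_scale.
    - intros; apply H; lra. }
  rewrite Rmult_assoc. destruct c; simpl.
  - apply Rle_trans with (RInt f (t * s) (t * 1)).
    + rewrite RInt_scale by (auto; lra). apply Rmult_le_compat_l; [lra|apply E; lra].
    + rewrite (RInt_split f (t * s) (t * 1) 1) by (auto; nra).
      generalize (RInt_nonneg f (t * 1) 1 Gf). lra.
  - replace 0 with (t * 0) at 2 by ring.
    rewrite RInt_scale by (auto; lra). apply Rmult_le_compat_l; [lra|apply E; lra].
Qed.

Lemma T_scale_le f g t p s : good f -> good g -> 0 <= t <= 1 ->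
  (forall r, 0 <= r <= 1 -> f (t * r) <= p * g r) -> 0 <= s <= 1 ->
  T false f (t * s) <= t * p * T false g s.
Proof.
  intros Gf Gg Ht H Hs. simpl.
  replace 0 with (t * 0) at 1 by ring. rewrite Rmult_assoc.
  rewrite RInt_scale by (auto; lra). apply Rmult_le_compat_l; [lra|].
  rewrite <- (RInt_scal (V:=R_CompleteNormedModule)) by (apply good_ex; auto; lra).
  apply RInt_le; [lra| | |].
  - apply (good_ex (fun r => f (t * r))); auto; try lra. now apply good_scale.
  - apply (ex_RInt_scal (V:=R_NormedModule)), good_ex; auto; lra.
  - intros; apply H; lra.
Qed.

Lemma Tw_scale_ge w f g t p s : good f -> good g -> 0 <= t <= 1 ->
  (forall r, 0 <= r <= 1 -> p * g r <= f (t * r)) -> 0 <= s <= 1 ->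
  t ^ length w * p * Tw w g s <= Tw w f (t * s).
Proof.
  revert f g p; induction w as [|c w IH]; simpl; intros f g p Gf Gg Ht H Hs.
  - rewrite Rmult_1_l; auto.
  - replace (t * t ^ length w * p) with (t ^ length w * (t * p)) by ring.
    apply IH; auto using T_good. intros; now apply T_scale_ge.
Qed.

Lemma Tw_ascending_scale_le k f g t p s : good f -> good g -> 0 <= t <= 1 ->
  (forall r, 0 <= r <= 1 -> f (t * r) <= p * g r) -> 0 <= s <= 1 ->
  Tw (repeat false k) f (t * s) <= t ^ k * p * Tw (repeat false k) g s.
Proof.
  revert f g p; induction k as [|k IH]; intros f g p Gf Gg Ht H Hs.
  - simpl. rewrite Rmult_1_l; auto.
  - replace (t ^ S k * p) with (t ^ k * (t * p)) by (simpl; ring).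
    apply IH; auto using T_good. intros; now apply T_scale_le.
Qed.

(** * Symmetry under reflection of the interval *)

(** Reflection exchanges ascents and descents, so later arguments treat one orientation only. With
    the flag [c], its effect on a letter is [xorb c]. *)
Definition flip (c : bool) (t : R) : R := if c then 1 - t else t.

Lemma flip_range c t : 0 <= t <= 1 -> 0 <= flip c t <= 1.
Proof. destruct c; simpl; lra. Qed.

Lemma flip_flip c t : flip c (flip c t) = t.
Proof. destruct c; simpl; lra. Qed.

Lemma RInt_reflect f (a b : R) : good f -> 0 <= a <= b -> b <= 1 ->
  is_RInt (fun s => f (1 - s)) (1 - b) (1 - a) (RInt f a b).
Proof.
  intros G Ha Hb.
  assert (H : is_RInt (fun y => scal (-1) (f (-1 * y + 1))) (1 - a) (1 - b) (RInt f a b)).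
  { apply (is_RInt_comp_lin (V:=R_NormedModule)).
    replace (-1 * (1 - a) + 1) with a by ring. replace (-1 * (1 - b) + 1) with b by ring.
    apply (RInt_correct (V:=R_CompleteNormedModule)), good_ex; auto. }
  apply (is_RInt_swap (V:=R_NormedModule)) in H.
  apply (is_RInt_opp (V:=R_NormedModule)) in H. rewrite opp_opp in H.
  apply (is_RInt_ext (V:=R_NormedModule)) with (2 := H).
  intros x _. unfold opp, scal; simpl; unfold mult; simpl.
  replace (-1 * x + 1) with (1 - x) by ring. ring.
Qed.

Lemma good_flip c f : good f -> good (fun s => f (flip c s)).
Proof.
  intros G. destruct c; simpl; [|exact G]. destruct (proj1 G) as [M HM]. split.
  - exists M. intros; apply HM; lra.
  - eexists. generalize (RInt_reflect f 0 1 G ltac:(lra) ltac:(lra)).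
    replace (1 - 1) with 0 by ring. rewrite Rminus_0_r. intros H; exact H.
Qed.

Lemma T_flip c d f t : good f -> 0 <= t <= 1 ->
  T d f (flip c t) = T (xorb c d) (fun s => f (flip c s)) t.
Proof.
  intros G Ht. destruct c; [|now destruct d].
  symmetry; destruct d; simpl; apply is_RInt_unique.
  - generalize (RInt_reflect f (1 - t) 1 G ltac:(lra) ltac:(lra)).
    now replace (1 - 1) with 0 by ring; replace (1 - (1 - t)) with t by ring.
  - generalize (RInt_reflect f 0 (1 - t) G ltac:(lra) ltac:(lra)).
    now rewrite Rminus_0_r; replace (1 - (1 - t)) with t by ring.
Qed.

Lemma Tw_flip c w f t : good f -> 0 <= t <= 1 ->
  Tw w f (flip c t) = Tw (map (xorb c) w) (fun s => f (flip c s)) t.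
Proof.
  revert f; induction w as [|d w IH]; simpl; intros f G Ht; auto.
  rewrite IH by auto using T_good. apply Tw_ext; auto.
  intros; now apply T_flip.
Qed.

Lemma st_flip c d x t : st d (flip c x) (flip c t) = st (xorb c d) x t.
Proof. destruct c, d; simpl; auto; repeat destruct (Rle_dec _ _); lra. Qed.

Lemma K_flip c w x t : 0 <= x <= 1 -> 0 <= t <= 1 ->
  K w (flip c x) (flip c t) = K (map (xorb c) w) x t.
Proof.
  intros Hx Ht. destruct w as [|d w]; simpl; auto.
  rewrite Tw_flip by auto using st_good, flip_range.
  apply Tw_ext; auto. intros; apply st_flip.
Qed.

(** * Approximate proportionality and the gain from one run *)

(** For [th > 0] this says that Hilbert's projective distance between [f] and [g] is at most
    [- ln th], in a division-free form that tolerates zeros. *)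
Definition cross (th : R) (f g : R -> R) : Prop :=
  forall s t, 0 <= s <= 1 -> 0 <= t <= 1 -> th * (f t * g s) <= f s * g t.

(** The inequality is linear in the values at [s] and in the values at [t], so the positive operator
    can be applied to the nonnegative difference first in [s], then in [t]. *)
Lemma cross_T th c f g : good f -> good g -> cross th f g -> cross th (T c f) (T c g).
Proof.
  intros Gf Gg H.
  assert (H1 : forall s t, 0 <= s <= 1 -> 0 <= t <= 1 ->
    th * (f t * T c g s) <= T c f s * g t).
  { intros s t Hs Ht.
    assert (Z : 0 <= T c (fun r => g t * f r + (- th * f t) * g r) s).
    { apply T_nonneg; auto. apply good_lin; auto. intros r Hr.
      generalize (H r t Hr Ht). nra. }
    rewrite T_lin in Z by auto. nra. }
  intros s t Hs Ht.
  assert (Z : 0 <= T c (fun r => T c f s * g r + (- th * T c g s) * f r) t).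
  { apply T_nonneg; auto. apply good_lin; auto. intros r Hr.
    generalize (H1 s r Hs Hr). nra. }
  rewrite T_lin in Z by auto. nra.
Qed.

Lemma cross_Tw th w f g : good f -> good g -> cross th f g -> cross th (Tw w f) (Tw w g).
Proof.
  revert f g; induction w; simpl; auto. intros; apply IHw; auto using T_good, cross_T.
Qed.

Lemma cross_le th th' f g : good f -> good g -> th' <= th -> cross th f g -> cross th' f g.
Proof.
  intros [[M HM] _] [[N HN] _] Hle H s t Hs Ht.
  apply Rle_trans with (2 := H s t Hs Ht). apply Rmult_le_compat_r; auto.
  apply Rmult_le_pos; [apply HM|apply HN]; auto.
Qed.

Lemma cross_flip th c f g :
  cross th (fun s => f (flip c s)) (fun s => g (flip c s)) -> cross th f g.
Proof.
  intros H s t Hs Ht.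
  generalize (H (flip c s) (flip c t) (flip_range c s Hs) (flip_range c t Ht)).
  now rewrite !flip_flip.
Qed.

Lemma is_RInt_pow k y : is_RInt (fun s => s ^ k) y 1 ((1 - y ^ S k) / INR (S k)).
Proof.
  assert (Hk : INR (S k) <> 0) by (apply not_0_INR; lia).
  replace ((1 - y ^ S k) / INR (S k))
    with (minus (1 ^ S k / INR (S k)) (y ^ S k / INR (S k))).
  2:{ unfold minus, plus, opp; simpl plus. rewrite pow1. simpl. field. exact Hk. }
  apply (is_RInt_derive (V:=R_CompleteNormedModule) (fun s => s ^ S k / INR (S k)) (fun s => s ^ k)).
  - intros x _. auto_derive; auto. simpl pred. field. exact Hk.
  - intros x _. apply continuity_pt_filterlim, derivable_continuous_pt, derivable_pt_pow.
Qed.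

(** Lower bound: [f r <= f (t * r)] because [f] is nonincreasing, and each of the [S k] ascents then
    contributes a factor [t]. Upper bound: the comparison has the right direction only after the
    first ascent has made the function nondecreasing, so [k] factors remain. *)
Lemma run_bounds k f : good f -> monotone true f ->
  let h := Tw (repeat false (S k)) f 1 in
  forall t, 0 <= t <= 1 ->
  t ^ S k * h <= Tw (repeat false (S k)) f t <= t ^ k * h.
Proof.
  intros G Hm h t Ht. split.
  - rewrite <- (Rmult_1_r t) at 2. rewrite <- (Rmult_1_r (t ^ S k)).
    rewrite <- (repeat_length false (S k)) at 1. apply Tw_scale_ge; auto; try lra.
    intros r Hr. rewrite Rmult_1_l. apply (Hm (t * r) r); nra.
  - rewrite <- (Rmult_1_r t) at 1. rewrite <- (Rmult_1_r (t ^ k)).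
    apply (Tw_ascending_scale_le k (T false f) (T false f)); auto using T_good; try lra.
    intros r Hr. rewrite Rmult_1_l. apply (T_monotone false f G); nra.
Qed.

(** For [b >= 1], the ratio of the integrals over [[0,1]] of the two profiles [t ^ b] and
    [t ^ (b - 1)] that enclose a run. *)
Definition kappa (b : nat) : R := INR b / INR (S b).

Lemma kappa_bounds b : 0 <= kappa b < 1.
Proof.
  unfold kappa. rewrite S_INR. generalize (pos_INR b). intros H.
  split; [apply Rdiv_le_0_compat; lra|].
  apply Rlt_div_l; lra.
Qed.

(** Integrate [run_bounds] over [[y,1]]. Replacing [y ^ S (S k)] by the larger [y ^ S k] in the
    lower integral gives both sides the same shape in [y], independent of [f] up to the factor
    [h]. *)
Lemma turn_bounds k f : good f -> monotone true f ->
  let h := Tw (repeat false (S k)) f 1 in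
  forall y, 0 <= y <= 1 ->
  kappa (S k) * (h * ((1 - y ^ S k) / INR (S k)))
    <= T true (Tw (repeat false (S k)) f) y <= h * ((1 - y ^ S k) / INR (S k)).
Proof.
  intros G Hm h y Hy. simpl T.
  assert (Hh : 0 <= h) by (apply good_nonneg; [now apply Tw_good | lra]).
  assert (I : forall j, RInt (fun s => h * s ^ j) y 1 = h * ((1 - y ^ S j) / INR (S j))).
  { intros j. apply is_RInt_unique. apply (is_RInt_scal (V:=R_NormedModule)), is_RInt_pow. }
  assert (EI : forall j, ex_RInt (fun s => h * s ^ j) y 1).
  { intros j. eexists. apply (is_RInt_scal (V:=R_NormedModule)), is_RInt_pow. }
  assert (EH : ex_RInt (Tw (repeat false (S k)) f) y 1) by (apply good_ex; auto using Tw_good; lra).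
  split.
  - apply Rle_trans with (RInt (fun s => h * s ^ S k) y 1).
    + rewrite I. unfold kappa.
      rewrite (S_INR (S k)).
      assert (HS : 0 < INR (S k)) by (apply lt_0_INR; lia).
      assert (Hp : y ^ S (S k) <= y ^ S k).
      { change (y ^ S (S k)) with (y * y ^ S k). generalize (pow_le y (S k) (proj1 Hy)). nra. }
      replace (INR (S k) / (INR (S k) + 1) * (h * ((1 - y ^ S k) / INR (S k))))
        with (h * ((1 - y ^ S k) / (INR (S k) + 1))) by (field; lra).
      apply Rmult_le_compat_l; auto. apply Rmult_le_compat_r; [|lra].
      left; apply Rinv_0_lt_compat; lra.
    + apply RInt_le; auto; try lra. intros x Hx. rewrite Rmult_comm.
      apply (run_bounds k f G Hm); lra.
  - rewrite <- I. apply RInt_le; auto; try lra. intros x Hx. rewrite (Rmult_comm h).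
    apply (run_bounds k f G Hm); lra.
Qed.

(** Both images are multiples of one common function up to a factor [kappa b]. The two multiples
    cancel in the cross product, and each of the two factors on the larger side costs one
    [kappa b]. *)
Lemma cross_run c b f g : (1 <= b)%nat -> good f -> good g ->
  monotone c f -> monotone c g ->
  cross (kappa b ^ 2) (Tw (repeat (negb c) b ++ [c]) f) (Tw (repeat (negb c) b ++ [c]) g).
Proof.
  intros Hb.
  assert (main : forall f g, good f -> good g -> monotone true f -> monotone true g ->
    cross (kappa b ^ 2) (Tw (repeat false b ++ [true]) f) (Tw (repeat false b ++ [true]) g)).
  { clear f g. intros f g Gf Gg Mf Mg s t Hs Ht. destruct b as [|k]; [lia|].
    rewrite !Tw_app. change (Tw [true]) with (T true).
    generalize (turn_bounds k f Gf Mf s Hs) (turn_bounds k f Gf Mf t Ht).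
    generalize (turn_bounds k g Gg Mg s Hs) (turn_bounds k g Gg Mg t Ht).
    generalize (T_nonneg true _ s (Tw_good (repeat false (S k)) f Gf) Hs).
    generalize (T_nonneg true _ t (Tw_good (repeat false (S k)) f Gf) Ht).
    generalize (T_nonneg true _ s (Tw_good (repeat false (S k)) g Gg) Hs).
    generalize (T_nonneg true _ t (Tw_good (repeat false (S k)) g Gg) Ht).
    set (p := Tw _ f 1). set (q := Tw _ g 1).
    set (u := T true _ s). set (u' := T true _ t). set (v := T true _ s). set (v' := T true _ t).
    set (A := (1 - s ^ S k) / _). set (B := (1 - t ^ S k) / _).
    generalize (kappa_bounds (S k)). set (x := kappa _).
    intros Hx N1 N2 N3 N4 [S1 S2] [S3 S4] [S5 S6] [S7 S8].
    apply Rle_trans with ((x * (p * A)) * (x * (q * B))).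
    - replace (x * (p * A) * (x * (q * B))) with (x ^ 2 * ((p * B) * (q * A))) by ring.
      apply Rmult_le_compat_l; [nra|]. apply Rmult_le_compat; auto.
    - apply Rmult_le_compat; auto; nra. }
  intros Gf Gg Mf Mg.
  destruct c; [now apply main|].
  apply cross_flip with true.
  assert (E : forall f, good f -> forall s, 0 <= s <= 1 ->
     Tw (repeat (negb false) b ++ [false]) f (flip true s)
     = Tw (repeat false b ++ [true]) (fun s => f (flip true s)) s).
  { clear. intros f G s Hs. rewrite Tw_flip by auto.
    rewrite map_app, map_repeat. reflexivity. }
  intros s t Hs Ht. rewrite !E by auto.
  apply main; auto.
  - now apply (good_flip true).
  - now apply (good_flip true).
  - intros y z Hy Hz. apply Mf; simpl; lra.
  - intros y z Hy Hz. apply Mg; simpl; lra.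
Qed.

(* The optimal constants [th * M <= f / g <= M]: [M] is the supremum of [f / g]. *)
Lemma cross_ratio_bounds th f g : 0 < th -> th <= 1 ->
  (forall t, 0 <= t <= 1 -> 0 <= f t) -> (forall t, 0 <= t <= 1 -> 0 <= g t) ->
  cross th f g ->
  (forall t, 0 <= t <= 1 -> g t = 0) \/
  exists M, 0 <= M /\ forall t, 0 <= t <= 1 -> th * M * g t <= f t <= M * g t.
Proof.
  intros Hth Hth1 Pf Pg H.
  destruct (classic (exists s, 0 <= s <= 1 /\ g s <> 0)) as [[s0 [Hs0 N0]]|N].
  2:{ left. intros t Ht. apply NNPP. intros Hg. apply N. eauto. }
  right. assert (P0 : 0 < g s0) by (generalize (Pg s0 Hs0); lra).
  pose (E := fun r => exists s, 0 <= s <= 1 /\ 0 < g s /\ r = f s / g s).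
  destruct (completeness E) as [M [HM1 HM2]].
  - exists (f s0 / (th * g s0)). intros r [s [Hs [Gs ->]]].
    apply Rle_div_l; auto. apply Rmult_le_reg_l with (th * g s0); [nra|].
    replace (th * g s0 * (f s0 / (th * g s0) * g s)) with (f s0 * g s) by (field; lra).
    generalize (H s0 s Hs0 Hs). lra.
  - exists (f s0 / g s0), s0. auto.
  - exists M. split.
    { apply Rle_trans with (f s0 / g s0).
      - apply Rdiv_le_0_compat; auto.
      - apply HM1. exists s0; auto. }
    intros t Ht. split.
    + destruct (Req_dec (g t) 0) as [Z|Z].
      { rewrite Z. generalize (Pf t Ht); lra. }
      assert (Gt : 0 < g t) by (generalize (Pg t Ht); lra).
      assert (M <= f t / (th * g t)).
      { apply HM2. intros r [s [Hs [Gs ->]]].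
        apply Rle_div_l; auto. apply Rmult_le_reg_l with (th * g t); [nra|].
        replace (th * g t * (f t / (th * g t) * g s)) with (f t * g s) by (field; lra).
        generalize (H t s Ht Hs). lra. }
      replace (f t) with (th * (f t / (th * g t)) * g t) by (field; lra).
      apply Rmult_le_compat_r; [lra|]. apply Rmult_le_compat_l; lra.
    (* Where [g] vanishes, comparison with the point [s0] forces [f] to vanish too. *)
    + destruct (Req_dec (g t) 0) as [Z|Z].
      { rewrite Z, Rmult_0_r. generalize (H s0 t Hs0 Ht). rewrite Z.
        intros Q. apply Rmult_le_reg_l with (th * g s0); nra. }
      assert (Gt : 0 < g t) by (generalize (Pg t Ht); lra).
      apply Rle_div_l; auto. apply HM1. exists t; auto.
Qed.

(** * Contraction and its behaviour under concatenation *)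

(** The defect [eta], rather than the ratio [1 - eta], is recorded because defects multiply under
    concatenation. *)
Definition mixing (w : list bool) (eta : R) : Prop :=
  forall f g, good f -> good g -> cross (1 - eta) (Tw w f) (Tw w g).

(* Birkhoff's contraction argument: apply [mixing] to the positive functions
   [f - m g] and [M g - f], where [m <= f / g <= M]. *)
Lemma mixing_contracts w eta xi f g :
  0 <= eta <= 1 -> 0 < xi < 1 -> mixing w eta -> good f -> good g ->
  cross (1 - xi) f g -> cross (1 - xi * eta) (Tw w f) (Tw w g).
Proof.
  intros He Hx Hw Gf Gg H.
  destruct (cross_ratio_bounds (1 - xi) f g ltac:(lra) ltac:(lra)
    (fun t => good_nonneg f t Gf) (fun t => good_nonneg g t Gg) H)
    as [Z|[M [HM B]]].
  { assert (ZT : forall s, 0 <= s <= 1 -> Tw w g s = 0).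
    { intros s Hs. rewrite (Tw_ext w g (fun s => 0 * g s + 0 * g s)); auto.
      - rewrite Tw_lin by auto. ring.
      - intros t Ht. rewrite Z by auto. ring. }
    intros s t Hs Ht. rewrite !ZT by auto. lra. }
  set (a := fun s => 1 * f s + (- ((1 - xi) * M)) * g s).
  set (b := fun s => M * g s + (-1) * f s).
  assert (Ga : good a) by (apply good_lin; auto; intros t Ht; generalize (B t Ht); lra).
  assert (Gb : good b) by (apply good_lin; auto; intros t Ht; generalize (B t Ht); lra).
  intros s t Hs Ht.
  generalize (Hw a b Ga Gb s t Hs Ht).
  generalize (good_nonneg _ s (Tw_good w a Ga) Hs) (good_nonneg _ t (Tw_good w a Ga) Ht).
  generalize (good_nonneg _ s (Tw_good w b Gb) Hs) (good_nonneg _ t (Tw_good w b Gb) Ht).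
  unfold a, b. rewrite !Tw_lin by auto.
  destruct HM as [HM|<-].
  2:{ intros.
    replace (Tw w f t) with 0 by lra. replace (Tw w f s) with 0 by lra. lra. }
  set (F := Tw w f s). set (F' := Tw w f t). set (G := Tw w g s). set (G' := Tw w g t).
  intros V V' U U' C.
  set (u := 1 * F + - ((1 - xi) * M) * G) in *.
  set (u' := 1 * F' + - ((1 - xi) * M) * G') in *.
  set (v := M * G + -1 * F) in *.
  set (v' := M * G' + -1 * F') in *.
  assert (XM : 0 < xi * M) by (apply Rmult_lt_0_compat; lra).
  (* Up to positive factors, [f] and [g] are the combinations [a + (1 - xi) * b] and [a + b], so the
     goal becomes an inequality between nonnegative [u], [u'], [v], [v']. *)
  assert (EG : xi * M * G = u + v) by (unfold u, v; ring).
  assert (EG' : xi * M * G' = u' + v') by (unfold u', v'; ring).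
  assert (EF : xi * F = u + (1 - xi) * v) by (unfold u, v; ring).
  assert (EF' : xi * F' = u' + (1 - xi) * v') by (unfold u', v'; ring).
  apply Rmult_le_reg_l with (xi * (xi * M)); [apply Rmult_lt_0_compat; lra|].
  replace (xi * (xi * M) * ((1 - xi * eta) * (F' * G)))
    with ((1 - xi * eta) * ((xi * F') * (xi * M * G))) by ring.
  replace (xi * (xi * M) * (F * G')) with ((xi * F) * (xi * M * G')) by ring.
  rewrite EG, EG', EF, EF'. clearbody u u' v v'.
  (* The difference of the two sides of the goal is exactly the sum of the quantities in [Z1] and
     [Z2]; [Z1] is the mixing property applied to [a] and [b]. *)
  assert (Z1 : 0 <= xi * (u * v' - (1 - eta) * (u' * v))) by (apply Rmult_le_pos; lra).
  assert (Z2 : 0 <= xi * eta * (u' * u + (1 - xi) * v' * (u + v))).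
  { apply Rmult_le_pos; [nra|]. apply Rplus_le_le_0_compat; [nra|].
    apply Rmult_le_pos; [|lra]. apply Rmult_le_pos; lra. }
  nra.
Qed.

Lemma mixing_trivial w : mixing w 1.
Proof.
  intros f g Gf Gg s t Hs Ht. rewrite Rminus_diag, Rmult_0_l.
  apply Rmult_le_pos; apply good_nonneg; auto using Tw_good.
Qed.

Lemma mixing_app v w xi eta : 0 < xi <= 1 -> 0 <= eta <= 1 ->
  mixing v xi -> mixing w eta -> mixing (v ++ w) (xi * eta).
Proof.
  intros Hx He Hv Hw f g Gf Gg. rewrite !Tw_app.
  (* At [xi = 1] the word [v] brings no information and [w] alone gives the bound;
     [mixing_contracts] handles [xi < 1]. *)
  destruct (Req_dec xi 1) as [->|Nx].
  - rewrite Rmult_1_l. apply Hw; auto using Tw_good.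
  - apply mixing_contracts; auto using Tw_good. lra.
Qed.

(** The leading letter makes any input monotone in the direction that [cross_run] asks for, and
    [kappa b >= 1 / 2] yields the ratio [1 / 4]. *)
Lemma mixing_turn c b : (1 <= b)%nat -> mixing (c :: repeat (negb c) b ++ [c]) (3 / 4).
Proof.
  intros Hb f g Gf Gg.
  apply cross_le with (kappa b ^ 2); [now apply Tw_good | now apply Tw_good | |].
  - assert (1 / 2 <= kappa b); [|nra].
    unfold kappa. rewrite S_INR. generalize (le_INR _ _ Hb). simpl (INR 1). intros.
    apply (proj1 (Rle_div_r (1 / 2) (INR b) (INR b + 1) ltac:(lra))). lra.
  - apply cross_run; auto using T_good, T_monotone.
Qed.

(** * Blocks of equal letters: many turns or one long block *)

Lemma lead_run_split c w :
  exists q, w = repeat c (lead_len c w) ++ q /\ (q = [] \/ exists r, q = negb c :: r).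
Proof.
  induction w as [|d w [q [E Q]]]; simpl.
  - exists []; auto.
  - destruct (Bool.eqb c d) eqn:B.
    + apply eqb_prop in B; subst d. exists q. simpl. now rewrite <- E.
    + exists (d :: w). split; auto. right. exists w. destruct c, d; easy.
Qed.

Lemma lead_len_repeat c k q : (k <= lead_len c (repeat c k ++ q))%nat.
Proof. induction k; simpl; [lia|]. rewrite eqb_reflx. lia. Qed.

Lemma prefix_const_len_repeat c k q : (k <= prefix_const_len (repeat c k ++ q))%nat.
Proof.
  destruct k; [simpl; lia|]. exact (lead_len_repeat c (S k) q).
Qed.

(** Letters are steps between cells, so a block of [k] letters is part of a run with at least
    [k + 1] cells. *)
Definition bounded_runs (N : nat) (w : list bool) : Prop :=
  forall p c k q, w = p ++ repeat c k ++ q -> (k <= N)%nat.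

Lemma bounded_runs_suffix N v w : bounded_runs N (v ++ w) -> bounded_runs N w.
Proof. intros H p c k q ->. apply (H (v ++ p) c k q). now rewrite app_assoc. Qed.

(** Each factor [3 / 4] uses up a block of at most [N] letters, the opposite block after it, also at
    most [N], and one further letter; [2 * N + 2] letters are enough for this. *)
Lemma mixing_bounded_runs N n w :
  bounded_runs N w -> (n * (2 * N + 2) <= length w)%nat -> mixing w ((3 / 4) ^ n).
Proof.
  revert w; induction n as [|n IH]; intros w B L.
  { apply mixing_trivial. }
  destruct w as [|c w]; [simpl in L; lia|]. set (v := c :: w) in *.
  destruct (lead_run_split c v) as [q [Ev Q]].
  assert (Ha : (1 <= lead_len c v)%nat) by (simpl; rewrite eqb_reflx; lia).
  set (a := lead_len c v) in *. clearbody a. clearbody v. clear w.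
  assert (Na : (a <= N)%nat) by exact (B [] c a q Ev).
  destruct Q as [->|[q' ->]].
  { rewrite Ev, length_app, repeat_length in L. simpl in L. lia. }
  destruct (lead_run_split (negb c) (negb c :: q')) as [r [Eq Q]].
  assert (Hb : (1 <= lead_len (negb c) (negb c :: q'))%nat)
    by (simpl; rewrite eqb_reflx; lia).
  set (b := lead_len _ _) in *. clearbody b. rewrite Eq in Ev. clear Eq q'.
  assert (Nb : (b <= N)%nat) by exact (B _ _ b r Ev).
  destruct Q as [->|[r' ->]].
  { rewrite Ev, !length_app, !repeat_length in L. simpl in L. lia. }
  rewrite negb_involutive in Ev.
  destruct a as [|a]; [lia|].
  (* The last letter of the first block opens the turn; the letters before it are absorbed with the
     trivial defect [1]. *)
  assert (E : v = (repeat c a ++ (c :: repeat (negb c) b ++ [c])) ++ r').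
  { rewrite Ev. replace (S a) with (a + 1)%nat by lia. rewrite repeat_app.
    rewrite <- !app_assoc. simpl. now rewrite <- !app_assoc. }
  rewrite E in B. apply bounded_runs_suffix in B.
  assert (Lr : (n * (2 * N + 2) <= length r')%nat).
  { rewrite Ev, !length_app, !repeat_length in L. simpl in L. lia. }
  specialize (IH r' B Lr). rewrite E. simpl.
  assert (P : 0 <= (3 / 4) ^ n <= 1).
  { split; [apply pow_le; lra|]. rewrite <- (pow1 n). apply pow_incr; lra. }
  apply mixing_app; auto; try lra.
  rewrite <- (Rmult_1_l (3 / 4)). apply mixing_app; try lra.
  - apply mixing_trivial.
  - now apply mixing_turn.
Qed.

(** Extend the block to a maximal one. Touching an end of the word would make it a constant prefix
    or suffix longer than [N], so an opposite letter stands on both sides. *)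
Lemma long_interior_run N w p c k q :
  w = p ++ repeat c k ++ q -> (N < k)%nat ->
  (prefix_const_len w <= N)%nat -> (prefix_const_len (rev w) <= N)%nat ->
  exists p' q' b, (N < b)%nat /\
    w = (p' ++ [negb c]) ++ (repeat c b ++ [negb c]) ++ q'.
Proof.
  intros E Hk HF HL.
  destruct (lead_run_split c (rev p)) as [r [Ep Q]].
  set (j := lead_len c (rev p)) in *. clearbody j.
  assert (Ep' : p = rev r ++ repeat c j).
  { rewrite <- (rev_involutive p), Ep, rev_app_distr, rev_repeat. reflexivity. }
  destruct (lead_run_split c q) as [r2 [Eq Q2]].
  set (i := lead_len c q) in *. clearbody i. clear Ep. subst p. rewrite Eq in E. clear Eq q.
  assert (E' : w = rev r ++ repeat c (j + k + i) ++ r2).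
  { rewrite E, !repeat_app, <- !app_assoc. reflexivity. }
  clear E.
  destruct Q as [->|[r' ->]].
  { simpl in E'. subst w. generalize (prefix_const_len_repeat c (j + k + i) r2). lia. }
  destruct Q2 as [->|[r2' ->]].
  { rewrite app_nil_r in E'. subst w. rewrite rev_app_distr, rev_repeat in HL.
    generalize (prefix_const_len_repeat c (j + k + i) (rev (rev (negb c :: r')))). lia. }
  exists (rev r'), r2', (j + k + i)%nat. split; [lia|].
  rewrite E'. simpl. now rewrite <- !app_assoc.
Qed.

Lemma kappa_le b b' : (b <= b')%nat -> kappa b <= kappa b'.
Proof.
  intros H. apply le_INR in H. unfold kappa. rewrite !S_INR.
  generalize (pos_INR b). intros.
  apply Rminus_le_0.
  replace (_ - _) with ((INR b' - INR b) / ((INR b + 1) * (INR b' + 1))) by (field; lra).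
  apply Rdiv_le_0_compat; nra.
Qed.

(** If all blocks have at most [N] letters, there are at least [n] disjoint turns. Otherwise a
    longer block lies inside: the opposite letter before it supplies the monotonicity for
    [cross_run], and the letters after it preserve the ratio. *)
Lemma K_cross N n eta w x x' :
  1 - kappa N ^ 2 <= eta -> (3 / 4) ^ n <= eta ->
  (prefix_const_len w <= N)%nat -> (prefix_const_len (rev w) <= N)%nat ->
  (n * (2 * N + 2) + 1 <= length w)%nat -> 0 <= x <= 1 -> 0 <= x' <= 1 ->
  cross (1 - eta) (K w x) (K w x').
Proof.
  intros HN Hn HF HL Hw Hx Hx'.
  destruct (classic (bounded_runs N w)) as [B|NB].
  (* The first letter is spent on the initial step function, whence the [+ 1] in the length
     hypothesis. *)
  - destruct w as [|c w]; [simpl in Hw; lia|]. simpl.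
    apply cross_le with (1 - (3 / 4) ^ n); auto using Tw_good, st_good; [lra|].
    apply mixing_bounded_runs with N; auto using st_good.
    + now apply (bounded_runs_suffix N [c] w).
    + simpl in Hw; lia.
  - assert (exists p c k q, w = p ++ repeat c k ++ q /\ (N < k)%nat) as [p [c [k [q [E Hk]]]]].
    { apply NNPP. intros H. apply NB. intros p c k q E.
      apply Nat.nlt_ge. intros L. apply H. exists p, c, k, q. auto. }
    destruct (long_interior_run N w p c k q E Hk HF HL) as [p' [q' [b [Hb E']]]].
    rewrite E'. rewrite !(K_app (p' ++ [negb c])) by (destruct p'; easy).
    rewrite !Tw_app.
    apply cross_le with (kappa b ^ 2); auto using Tw_good, K_good.
    + generalize (kappa_le N b ltac:(lia)) (kappa_bounds N). intros.
      assert (kappa N ^ 2 <= kappa b ^ 2) by (apply pow_incr; lra). lra.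
    + apply cross_Tw; auto using Tw_good, K_good. rewrite <- !Tw_app.
      generalize (cross_run (negb c) b (K (p' ++ [negb c]) x) (K (p' ++ [negb c]) x')).
      rewrite negb_involutive. intros H.
      apply H; auto using K_good, K_last_monotone. lia.
Qed.

(** * Short end runs make the kernel comparable to its maximum on a half interval *)

(** For initial descents the kernel is largest at starting point [1]. Scaling the start down to
    [x' >= 1 / 2] costs at most [x' ^ a], hence the constant [2 ^ a]. *)
Lemma first_run_half c a w : (1 <= a)%nat ->
  exists u, 0 <= u <= 1 / 2 /\ forall x' x t, u <= x' <= u + 1 / 2 ->
    0 <= x <= 1 -> 0 <= t <= 1 ->
    K (repeat c a ++ negb c :: w) x t <= 2 ^ a * K (repeat c a ++ negb c :: w) x' t.
Proof.
  intros Ha.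
  assert (main : forall w x' x t, 1 / 2 <= x' <= 1 / 2 + 1 / 2 ->
    0 <= x <= 1 -> 0 <= t <= 1 ->
    K (repeat true a ++ false :: w) x t <= 2 ^ a * K (repeat true a ++ false :: w) x' t).
  { clear w. intros w x' x t Hx' Hx Ht.
    assert (I' : 0 <= x' <= 1) by lra.
    replace (repeat true a ++ false :: w) with ((repeat true a ++ [false]) ++ w)
      by (rewrite <- app_assoc; reflexivity).
    rewrite !(K_app (repeat true a ++ [false])) by (destruct a; easy).
    set (v := repeat true a ++ [false]).
    replace (2 ^ a * Tw w (K v x') t)
      with (Tw w (fun s => 2 ^ a * K v x' s + 0 * K v x' s) t)
      by (rewrite Tw_lin by auto using K_good; ring).
    assert (P2 : 0 < 2 ^ a) by (apply pow_lt; lra).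
    apply Tw_le; auto using K_good.
    { apply good_lin; auto using K_good. intros s Hs.
      generalize (good_nonneg _ s (K_good v x' I') Hs). nra. }
    intros s Hs. rewrite Rmult_0_l, Rplus_0_r.
    assert (M1 : K v x s <= K v 1 s).
    { unfold v. destruct a as [|a]; [lia|]. cbn [K repeat app]. apply Tw_le; auto.
      - now apply st_good.
      - apply st_good; lra.
      - intros r Hr. unfold st. repeat destruct (Rle_dec _ _); lra. }
    (* The ascent that closes the run makes the kernel nondecreasing, which removes the scaling of
       [s]. *)
    assert (M2 : K v x' (x' * s) <= K v x' s).
    { apply (K_last_monotone (repeat true a) false x' I'); nra. }
    assert (M3 : x' ^ a * K v 1 s <= K v x' (x' * s)).
    { unfold v. destruct a as [|a]; [lia|]. cbn [K repeat app].
      rewrite <- (Rmult_1_r (x' ^ S a)).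
      replace (S a) with (length (repeat true a ++ [false])) at 1
        by (rewrite length_app, repeat_length; simpl; lia).
      apply Tw_scale_ge; auto.
      - now apply (st_good true).
      - apply (st_good true); lra.
      - intros r Hr. unfold st. repeat destruct (Rle_dec _ _); try lra. nra. }
    assert (M4 : 1 <= 2 ^ a * x' ^ a).
    { rewrite <- Rpow_mult_distr. apply pow_R1_Rle. lra. }
    generalize (good_nonneg _ s (K_good v 1 ltac:(lra)) Hs). intros.
    apply Rle_trans with (2 ^ a * (x' ^ a * K v 1 s)); [nra|].
    apply Rmult_le_compat_l; lra. }
  destruct c.
  - exists (1 / 2). split; [lra|]. apply main.
  - exists 0. split; [lra|]. intros x' x t Hx' Hx Ht.
    assert (E : forall y, 0 <= y <= 1 -> K (repeat false a ++ negb false :: w) y t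
      = K (repeat true a ++ false :: map (xorb true) w) (1 - y) (1 - t)).
    { intros y Hy. rewrite <- (flip_flip true y) at 1. rewrite <- (flip_flip true t) at 1.
      rewrite K_flip by (simpl; lra). now rewrite map_app, map_repeat. }
    rewrite !E by lra. apply main; lra.
Qed.

(** When the last run ascends, the function before it is nonincreasing, so scaling gives at least
    [t' ^ a] times the value at [1], which is the maximum. *)
Lemma last_run_half c a w : (1 <= a)%nat ->
  exists u, 0 <= u <= 1 / 2 /\ forall t' x t, u <= t' <= u + 1 / 2 ->
    0 <= x <= 1 -> 0 <= t <= 1 ->
    K (w ++ negb c :: repeat c a) x t <= 2 ^ a * K (w ++ negb c :: repeat c a) x t'.
Proof.
  intros Ha.
  assert (main : forall w t' x t, 1 / 2 <= t' <= 1 / 2 + 1 / 2 ->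
    0 <= x <= 1 -> 0 <= t <= 1 ->
    K (w ++ true :: repeat false a) x t <= 2 ^ a * K (w ++ true :: repeat false a) x t').
  { clear w. intros w t' x t Ht' Hx Ht.
    assert (M1 : K (w ++ true :: repeat false a) x t <= K (w ++ true :: repeat false a) x 1).
    { destruct a as [|a]; [lia|]. rewrite <- (Nat.add_1_r a), repeat_app, app_comm_cons, app_assoc.
      apply (K_last_monotone _ false x Hx); lra. }
    replace (w ++ true :: repeat false a) with ((w ++ [true]) ++ repeat false a) in *
      by (rewrite <- app_assoc; reflexivity).
    rewrite !(K_app (w ++ [true])) in * by (destruct w; easy).
    set (h := K (w ++ [true]) x) in *.
    assert (G : good h) by now apply K_good.
    assert (M3 : t' ^ a * 1 * Tw (repeat false a) h 1 <= Tw (repeat false a) h (t' * 1)).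
    { rewrite <- (repeat_length false a) at 1. apply Tw_scale_ge; auto; try lra.
      intros r Hr. rewrite Rmult_1_l. apply (K_last_monotone w true x Hx); nra. }
    rewrite !Rmult_1_r in M3.
    assert (P2 : 0 < 2 ^ a) by (apply pow_lt; lra).
    assert (M4 : 1 <= 2 ^ a * t' ^ a).
    { rewrite <- Rpow_mult_distr. apply pow_R1_Rle. lra. }
    assert (N : 0 <= Tw (repeat false a) h 1) by (apply good_nonneg; [auto using Tw_good|lra]).
    apply Rle_trans with (2 ^ a * (t' ^ a * Tw (repeat false a) h 1)); [nra|].
    apply Rmult_le_compat_l; lra. }
  destruct c.
  - exists 0. split; [lra|]. intros t' x t Ht' Hx Ht.
    assert (E : forall y, 0 <= y <= 1 -> K (w ++ negb true :: repeat true a) x y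
      = K (map (xorb true) w ++ true :: repeat false a) (1 - x) (1 - y)).
    { intros y Hy. rewrite <- (flip_flip true y) at 1. rewrite <- (flip_flip true x) at 1.
      rewrite K_flip by (simpl; lra). rewrite map_app. simpl. now rewrite map_repeat. }
    rewrite !E by lra. apply main; lra.
  - exists (1 / 2). split; [lra|]. apply main.
Qed.

(** * Regularity in the starting point *)

Lemma Tw_bound w f M t : good f -> (forall s, 0 <= s <= 1 -> f s <= M) ->
  0 <= t <= 1 -> Tw w f t <= M.
Proof.
  revert f; induction w as [|c w IH]; simpl; auto. intros f G H Ht.
  apply IH; auto using T_good. intros s Hs.
  apply Rle_trans with (RInt f 0 1); [now apply T_le_RInt|].
  generalize (RInt_bound f 0 1 M G ltac:(lra) ltac:(lra) H). lra.
Qed.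

Lemma K_le_1 w x t : 0 <= x <= 1 -> 0 <= t <= 1 -> K w x t <= 1.
Proof.
  intros Hx Ht. destruct w as [|c w]; simpl; [lra|].
  apply Tw_bound; auto using st_good.
  intros s Hs. unfold st. destruct c; destruct (Rle_dec _ _); lra.
Qed.

(** One integration turns an integral distance into a uniform one, and the following ones do not
    increase it. *)
Lemma Tw_diff_bound c w f g t : good f -> good g ->
  (forall s, 0 <= s <= 1 -> f s <= g s) -> 0 <= t <= 1 ->
  0 <= Tw (c :: w) g t - Tw (c :: w) f t <= RInt g 0 1 - RInt f 0 1.
Proof.
  intros Gf Gg H Ht.
  assert (G : good (fun s => 1 * g s + (-1) * f s)).
  { apply good_lin; auto. intros s Hs. generalize (H s Hs). lra. }
  replace (Tw (c :: w) g t - Tw (c :: w) f t)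
    with (Tw (c :: w) (fun s => 1 * g s + (-1) * f s) t)
    by (rewrite Tw_lin by auto; ring).
  split; [apply good_nonneg; auto using Tw_good|].
  simpl. apply Tw_bound; auto using T_good. intros s Hs.
  apply Rle_trans with (1 := T_le_RInt c _ s G Hs).
  rewrite RInt_lin by (apply good_ex; auto; lra). lra.
Qed.

(** Two step functions are at integral distance [x' - x]. A second letter is required, since with a
    single one the kernel jumps in [x]. *)
Lemma K_lipschitz w x x' t : (2 <= length w)%nat ->
  0 <= x <= x' -> x' <= 1 -> 0 <= t <= 1 ->
  Rabs (K w x' t - K w x t) <= 1 * (x' - x).
Proof.
  intros L Hx Hx' Ht. destruct w as [|c [|d w]]; simpl in L; try lia.
  assert (G : good (st c x)) by (apply st_good; lra).
  assert (G' : good (st c x')) by (apply st_good; lra).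
  assert (I : RInt (st c x) 0 1 = if c then x else 1 - x)
    by (apply is_RInt_unique, is_RInt_st; lra).
  assert (I' : RInt (st c x') 0 1 = if c then x' else 1 - x')
    by (apply is_RInt_unique, is_RInt_st; lra).
  cbn [K]. destruct c.
  - destruct (Tw_diff_bound d w (st true x) (st true x') t); auto.
    { intros s Hs. unfold st. repeat destruct (Rle_dec _ _); lra. }
    apply Rabs_le; lra.
  - destruct (Tw_diff_bound d w (st false x') (st false x) t); auto.
    { intros s Hs. unfold st. repeat destruct (Rle_dec _ _); lra. }
    apply Rabs_le; lra.
Qed.

Lemma K_good_start w t : (2 <= length w)%nat -> 0 <= t <= 1 -> good (fun x => K w x t).
Proof.
  intros L Ht. split.
  - exists 1. intros x Hx. split; [apply good_nonneg; auto using K_good|now apply K_le_1].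
  - apply lipschitz_ex_RInt with 1. intros x x' Hx Hx'. now apply K_lipschitz.
Qed.

(** A full integral is one more ascent read at [1], so marginals inherit the regularity of the
    kernel of a longer word. *)
Lemma RInt_K w x : w <> [] -> RInt (K w x) 0 1 = K (w ++ [false]) x 1.
Proof. intros H. now rewrite K_app. Qed.

Lemma K_marginal_good w : (2 <= length w)%nat -> good (fun x => RInt (K w x) 0 1).
Proof.
  intros L. apply good_ext with (fun x => K (w ++ [false]) x 1).
  - intros x _. rewrite RInt_K; auto. now destruct w.
  - apply K_good_start; [|lra]. rewrite length_app. lia.
Qed.

(** * Bounds on the marginals and integration of the cross inequality *)

Lemma half_mass f u m : good f -> 0 <= u <= 1 / 2 ->
  (forall t, u <= t <= u + 1 / 2 -> m <= f t) -> m / 2 <= RInt f 0 1.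
Proof.
  intros G Hu H.
  rewrite (RInt_split f 0 u 1), (RInt_split f u (u + 1 / 2) 1) by (auto; lra).
  assert (m / 2 <= RInt f u (u + 1 / 2)).
  { replace (m / 2) with (m * (u + 1 / 2 - u)) by field. rewrite <- RInt_cst.
    apply RInt_le; [lra|apply ex_RInt_const|apply good_ex; auto; lra|].
    intros; apply H; lra. }
  generalize (RInt_nonneg f 0 u G ltac:(lra) ltac:(lra)).
  generalize (RInt_nonneg f (u + 1 / 2) 1 G ltac:(lra) ltac:(lra)). lra.
Qed.

Lemma RInt_mono f g : good f -> good g ->
  (forall t, 0 <= t <= 1 -> f t <= g t) -> RInt f 0 1 <= RInt g 0 1.
Proof.
  intros Gf Gg H. apply RInt_le; try (apply good_ex; auto; lra); [lra|].
  intros; apply H; lra.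
Qed.

Lemma RInt_mult m f : good f -> RInt (fun t => m * f t) 0 1 = m * RInt f 0 1.
Proof.
  intros G. apply (RInt_scal (V:=R_CompleteNormedModule)), good_ex; auto; lra.
Qed.

Lemma good_mult m f : 0 <= m -> good f -> good (fun t => m * f t).
Proof.
  intros Hm G. apply good_ext with (fun t => m * f t + 0 * f t).
  - intros; ring.
  - apply good_lin; auto. intros t Ht. generalize (good_nonneg f t G Ht). nra.
Qed.

Definition total (w : list bool) : R := RInt (fun x => RInt (K w x) 0 1) 0 1.

(** On a half interval the marginal is at least [2 ^ (- k)] times its value at [x], where [k] is the
    length of the first block; averaging over that half costs the additional factor [2]. The
    condition [a < length w] guarantees a second block. *)
Lemma first_marginal_bound w a : (2 <= length w)%nat ->
  (prefix_const_len w <= a < length w)%nat ->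
  forall x, 0 <= x <= 1 -> RInt (K w x) 0 1 <= 2 ^ S a * total w.
Proof.
  intros L [Ha Hl] x Hx. destruct w as [|c w]; [simpl in L; lia|].
  destruct (lead_run_split c (c :: w)) as [q [E Q]].
  assert (H1 : (1 <= lead_len c (c :: w))%nat) by (simpl; rewrite eqb_reflx; lia).
  change (lead_len c (c :: w) <= a)%nat in Ha.
  set (k := lead_len c (c :: w)) in *. clearbody k.
  destruct Q as [->|[r ->]].
  { rewrite E, app_nil_r, repeat_length in Hl. lia. }
  set (v := c :: w) in *. clearbody v. clear w.
  destruct (first_run_half c k r H1) as [u [Hu HB]]. rewrite <- E in HB.
  assert (P : 2 ^ k <= 2 ^ a) by (apply Rle_pow; lra || lia).
  assert (P2 : 0 < 2 ^ k) by (apply pow_lt; lra).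
  assert (Z : RInt (K v x) 0 1 / 2 ^ k / 2 <= total v).
  { apply half_mass with u; auto using K_marginal_good.
    intros x' Hx'. apply Rle_div_l; auto. rewrite Rmult_comm.
    rewrite <- RInt_mult by (apply K_good; lra).
    apply RInt_mono; auto using K_good.
    apply good_mult; [lra|apply K_good; lra]. }
  assert (N : 0 <= total v) by (apply RInt_nonneg; auto using K_marginal_good; lra).
  apply Rle_trans with (2 ^ S k * total v).
  - simpl. rewrite (Rmult_comm 2), !Rmult_assoc. rewrite (Rmult_comm (2 ^ k)).
    apply Rle_div_l; auto. lra.
  - apply Rmult_le_compat_r; auto. simpl. lra.
Qed.

(** For each start [x] the kernel at [t] is controlled by its mean over the last coordinate; this
    bound is then integrated over [x]. *)
Lemma last_marginal_bound w a : (2 <= length w)%nat ->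
  (prefix_const_len (rev w) <= a < length w)%nat ->
  forall t, 0 <= t <= 1 -> RInt (fun x => K w x t) 0 1 <= 2 ^ S a * total w.
Proof.
  intros L [Ha Hl] t Ht. destruct (rev w) as [|c w'] eqn:Er.
  { rewrite <- length_rev, Er in L. simpl in L. lia. }
  destruct (lead_run_split c (c :: w')) as [q [E Q]].
  assert (H1 : (1 <= lead_len c (c :: w'))%nat) by (simpl; rewrite eqb_reflx; lia).
  change (lead_len c (c :: w') <= a)%nat in Ha.
  set (k := lead_len c (c :: w')) in *. clearbody k.
  rewrite E in Er. clear E w'.
  destruct Q as [->|[r ->]].
  { rewrite <- length_rev, Er, app_nil_r, repeat_length in Hl. lia. }
  assert (E : w = rev r ++ negb c :: repeat c k).
  { rewrite <- (rev_involutive w), Er, rev_app_distr, rev_repeat. simpl.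
    now rewrite <- app_assoc. }
  destruct (last_run_half c k (rev r) H1) as [u [Hu HB]]. rewrite <- E in HB. clear E Er r.
  assert (P : 2 ^ k <= 2 ^ a) by (apply Rle_pow; lra || lia).
  assert (P2 : 0 < 2 ^ k) by (apply pow_lt; lra).
  assert (Z : forall x, 0 <= x <= 1 -> K w x t <= 2 ^ S k * RInt (K w x) 0 1).
  { intros x Hx.
    assert (Y : K w x t / 2 ^ k / 2 <= RInt (K w x) 0 1).
    { apply half_mass with u; auto using K_good.
      intros t' Ht'. apply Rle_div_l; auto. rewrite Rmult_comm. now apply HB. }
    simpl. rewrite (Rmult_comm 2), !Rmult_assoc. rewrite (Rmult_comm (2 ^ k)).
    apply Rle_div_l; auto. lra. }
  assert (P3 : 0 <= 2 ^ S k) by (simpl; lra).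
  assert (N : 0 <= total w) by (apply RInt_nonneg; auto using K_marginal_good; lra).
  apply Rle_trans with (2 ^ S k * total w).
  - unfold total. rewrite <- RInt_mult by auto using K_marginal_good.
    apply RInt_mono; auto using K_good_start, good_mult, K_marginal_good.
  - apply Rmult_le_compat_r; auto. simpl. lra.
Qed.

(** Integrate the cross inequality over the free end point, then over the second starting point
    [x']. Exchanging the roles of [y] and [t] gives the two directions. *)
Lemma cross_integrated w th : (2 <= length w)%nat -> 0 <= th ->
  (forall x x', 0 <= x <= 1 -> 0 <= x' <= 1 -> cross th (K w x) (K w x')) ->
  forall x y, 0 <= x <= 1 -> 0 <= y <= 1 ->
  th * (RInt (K w x) 0 1 * RInt (fun x => K w x y) 0 1) <= K w x y * total w /\
  th * (K w x y * total w) <= RInt (K w x) 0 1 * RInt (fun x => K w x y) 0 1.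
Proof.
  intros L Hth H x y Hx Hy.
  assert (P : forall x y, 0 <= x <= 1 -> 0 <= y <= 1 -> 0 <= K w x y)
    by (intros; apply good_nonneg; auto using K_good).
  assert (PM : forall x, 0 <= x <= 1 -> 0 <= RInt (K w x) 0 1)
    by (intros z Hz; apply RInt_nonneg; auto using K_good; lra).
  assert (S1 : forall x', 0 <= x' <= 1 ->
    th * K w x' y * RInt (K w x) 0 1 <= K w x y * RInt (K w x') 0 1).
  { intros x' Hx'. rewrite <- !RInt_mult by auto using K_good.
    apply RInt_mono; auto using good_mult, K_good, Rmult_le_pos.
    intros t Ht. generalize (H x x' Hx Hx' y t Hy Ht). lra. }
  assert (S2 : forall x', 0 <= x' <= 1 ->
    th * K w x y * RInt (K w x') 0 1 <= K w x' y * RInt (K w x) 0 1).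
  { intros x' Hx'. rewrite <- !RInt_mult by auto using K_good.
    apply RInt_mono; auto using good_mult, K_good, Rmult_le_pos.
    intros t Ht. generalize (H x x' Hx Hx' t y Ht Hy). lra. }
  split.
  - replace (th * (RInt (K w x) 0 1 * RInt (fun x => K w x y) 0 1))
      with ((th * RInt (K w x) 0 1) * RInt (fun x => K w x y) 0 1) by ring.
    unfold total. rewrite <- (RInt_mult (th * RInt (K w x) 0 1)) by auto using K_good_start.
    rewrite <- (RInt_mult (K w x y)) by auto using K_marginal_good.
    apply RInt_mono; auto using good_mult, K_good_start, K_marginal_good, Rmult_le_pos.
    intros x' Hx'. generalize (S1 x' Hx'). lra.
  - rewrite <- Rmult_assoc.
    unfold total. rewrite <- (RInt_mult (RInt (K w x) 0 1)) by auto using K_good_start.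
    rewrite <- (RInt_mult (th * K w x y)) by auto using K_marginal_good.
    apply RInt_mono; auto using good_mult, K_good_start, K_marginal_good, Rmult_le_pos.
    intros x' Hx'. generalize (S2 x' Hx'). lra.
Qed.

(** * Translation to the densities of the model and final estimate *)

Lemma Rint_RInt f (a b : R) : ex_RInt f a b -> Rint f a b = RInt f a b.
Proof.
  intros H. unfold Rint. destruct (excluded_middle_informative _) as [I|N].
  - symmetry. apply RInt_Reals.
  - destruct N. constructor. now apply ex_RInt_Reals_0.
Qed.

Lemma Rint_good f g : good g -> (forall t, 0 <= t <= 1 -> f t = g t) ->
  Rint f 0 1 = RInt g 0 1.
Proof.
  intros G H. rewrite Rint_RInt.
  - apply RInt_ext. rewrite Rmin_left, Rmax_right by lra. intros; apply H; lra.
  - apply (good_ext g f); auto. intros; symmetry; auto.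
Qed.

Lemma is_RInt_st_mult c f t : good f -> 0 <= t <= 1 ->
  is_RInt (fun s => f s * st c s t) 0 1 (T c f t).
Proof.
  intros G Ht.
  assert (Z : forall a b, a <= b -> (forall s, a < s < b -> f s * st c s t = 0) ->
    is_RInt (fun s => f s * st c s t) a b 0).
  { intros a b Hab H. rewrite <- (Rmult_0_l (b - a)). now apply is_RInt_cst. }
  assert (O : forall a b, 0 <= a <= b -> b <= 1 ->
    (forall s, a < s < b -> f s * st c s t = f s) ->
    is_RInt (fun s => f s * st c s t) a b (RInt f a b)).
  { intros a b Ha Hb H. apply (is_RInt_ext (V:=R_NormedModule)) with f.
    - rewrite Rmin_left, Rmax_right by lra. intros s Hs. now rewrite H.
    - apply (RInt_correct (V:=R_CompleteNormedModule)), good_ex; auto. }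
  destruct c.
  - replace (T true f t) with (plus 0 (RInt f t 1)) by apply Rplus_0_l.
    apply (is_RInt_Chasles (V:=R_NormedModule)) with t; [apply Z|apply O]; try lra;
    intros s Hs; unfold st; destruct (Rle_dec _ _); lra.
  - replace (T false f t) with (plus (RInt f 0 t) 0) by apply Rplus_0_r.
    apply (is_RInt_Chasles (V:=R_NormedModule)) with t; [apply O|apply Z]; try lra;
    intros s Hs; unfold st; destruct (Rle_dec _ _); lra.
Qed.

Lemma kern_K lam m x t : 0 <= x <= 1 -> 0 <= t <= 1 ->
  kern lam (S m) x t = K (map (isDesc lam) (seq 1 (S m))) x t.
Proof.
  intros Hx. revert t. induction m as [|m IH]; intros t Ht; [reflexivity|].
  rewrite (seq_S (S m)), map_app, K_app by easy. simpl Tw.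
  change (kern lam (S (S m)) x t)
    with (Rint (fun s => kern lam (S m) x s * st (isDesc lam (S (S m))) s t) 0 1).
  set (v := map (isDesc lam) (seq 1 (S m))) in *.
  assert (Hi := is_RInt_st_mult (isDesc lam (S (S m))) (K v x) t (K_good v x Hx) Ht).
  assert (E : is_RInt (fun s => kern lam (S m) x s * st (isDesc lam (S (S m))) s t) 0 1
    (T (isDesc lam (S (S m))) (K v x) t)).
  { apply (is_RInt_ext (V:=R_NormedModule)) with (2 := Hi).
    rewrite Rmin_left, Rmax_right by lra. intros s Hs. rewrite IH by lra. reflexivity. }
  rewrite Rint_RInt by (eexists; exact E). now apply is_RInt_unique.
Qed.

Lemma densities lam : (3 <= comp_size lam)%nat ->
  let w := pattern lam in
  forall x y, 0 <= x <= 1 -> 0 <= y <= 1 ->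
  dIF lam x y = K w x y / total w /\
  dI lam x = RInt (K w x) 0 1 / total w /\
  dF lam y = RInt (fun x => K w x y) 0 1 / total w.
Proof.
  intros L w.
  assert (EK : forall x y, 0 <= x <= 1 -> 0 <= y <= 1 ->
    kern lam (comp_size lam - 1) x y = K w x y).
  { intros x y Hx Hy. unfold w, pattern, comp_size in *.
    destruct (list_sum lam - 1)%nat as [|m] eqn:E; [lia|]. now apply kern_K. }
  assert (Lw : (2 <= length w)%nat).
  { unfold w, pattern, comp_size in *. rewrite length_map, length_seq. lia. }
  assert (EV : volP lam = total w).
  { apply Rint_good; auto using K_marginal_good. intros x Hx.
    apply Rint_good; auto using K_good. }
  assert (N : 0 <= total w) by (apply RInt_nonneg; auto using K_marginal_good; lra).
  (* This covers a vanishing total as well, by the convention [/ 0 = 0]. *)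
  assert (NI : 0 <= / total w).
  { destruct (Req_dec (total w) 0) as [->|]; [rewrite Rinv_0; lra|].
    left; apply Rinv_0_lt_compat; lra. }
  assert (ED : forall x y, 0 <= x <= 1 -> 0 <= y <= 1 -> dIF lam x y = / total w * K w x y).
  { intros x y Hx Hy. unfold dIF. rewrite EK, EV by auto. apply Rmult_comm. }
  intros x y Hx Hy. split; [|split].
  - rewrite ED by auto. apply Rmult_comm.
  - unfold Rdiv. rewrite Rmult_comm, <- RInt_mult by auto using K_good.
    apply Rint_good; auto using good_mult, K_good.
  - unfold Rdiv. rewrite Rmult_comm, <- RInt_mult by auto using K_good_start.
    apply Rint_good; auto using good_mult, K_good_start.
Qed.

(* For [V = 0] every quotient below is [0]. *)
Lemma normalized_gap_bound eta C k p q V :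
  0 <= eta <= 1 / 2 -> 0 <= V -> 0 <= C -> 0 <= p <= C * V -> 0 <= q <= C * V ->
  (1 - eta) * (p * q) <= k * V -> (1 - eta) * (k * V) <= p * q ->
  Rabs (k / V - p / V * (q / V)) <= 2 * eta * C ^ 2.
Proof.
  intros He HV HC Hp Hq H1 H2.
  destruct (Req_dec V 0) as [->|NV].
  { unfold Rdiv. rewrite !Rinv_0, !Rmult_0_r, Rminus_diag, Rabs_R0.
    apply Rmult_le_pos; [lra|apply pow2_ge_0]. }
  assert (PV : 0 < V) by lra.
  set (s := k / V). set (P := p / V * (q / V)).
  assert (HP : 0 <= P <= C ^ 2).
  { assert (0 <= p / V <= C) by (split; [apply Rdiv_le_0_compat; lra|apply Rle_div_l; lra]).
    assert (0 <= q / V <= C) by (split; [apply Rdiv_le_0_compat; lra|apply Rle_div_l; lra]).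
    unfold P. split; [apply Rmult_le_pos; lra|].
    replace (C ^ 2) with (C * C) by ring. apply Rmult_le_compat; lra. }
  assert (PV2 : 0 < V * V) by nra.
  assert (L1 : (1 - eta) * P <= s).
  { replace s with (k * V / (V * V)) by (unfold s; field; lra).
    replace ((1 - eta) * P) with ((1 - eta) * (p * q) / (V * V)) by (unfold P; field; lra).
    apply Rmult_le_compat_r; auto. left; now apply Rinv_0_lt_compat. }
  assert (L2 : (1 - eta) * s <= P).
  { replace P with (p * q / (V * V)) by (unfold P; field; lra).
    replace ((1 - eta) * s) with ((1 - eta) * (k * V) / (V * V)) by (unfold s; field; lra).
    apply Rmult_le_compat_r; auto. left; now apply Rinv_0_lt_compat. }
  clearbody s P.
  assert (0 <= eta * P) by (apply Rmult_le_pos; lra).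
  (* From [1 - eta >= 1 / 2]; then [s - P <= eta * s <= 2 * eta * P]. *)
  assert (s <= 2 * P) by nra.
  assert (eta * s <= eta * (2 * P)) by (apply Rmult_le_compat_l; lra).
  assert (eta * P <= eta * C ^ 2) by (apply Rmult_le_compat_l; lra).
  apply Rabs_le. lra.
Qed.

Theorem mainTheorem2 (eps A : R) (Heps : 0 < eps) (HA : 0 <= A) :
  exists n0 : nat,
    forall lam : list nat,
      is_composition lam ->
      (n0 <= comp_size lam)%nat ->
      INR (first_run_len lam) <= A ->
      INR (last_run_len lam) <= A ->
      (* sup_{(x,y) in [0,1]^2} |d_{XI,XF}(x,y) - d_{XI}(x) d_{XF}(y)| < eps *)
      exists e : R, e < eps /\
        forall x y : R, 0 <= x <= 1 -> 0 <= y <= 1 ->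
          Rabs (dIF lam x y - dI lam x * dF lam y) <= e.
Proof.
  destruct (INR_unbounded A) as [a Ha].
  set (C := 2 ^ S a). assert (HC : 0 < C) by (apply pow_lt; lra).
  assert (HC2 : 0 < C ^ 2) by (apply pow_lt; lra).
  (* [C] will bound both marginal densities. The second term brings [2 * eta * C ^ 2] down to
     [eps / 2]; the cap [1 / 2] serves [normalized_gap_bound]. *)
  set (eta := Rmin (1 / 2) (eps / (4 * C ^ 2))).
  assert (He : 0 < eta <= 1 / 2).
  { split; [|apply Rmin_l]. apply Rmin_glb_lt; [lra|]. apply Rdiv_lt_0_compat; lra. }
  assert (Hee : 2 * eta * C ^ 2 < eps).
  { apply Rle_lt_trans with (2 * (eps / (4 * C ^ 2)) * C ^ 2).
    - apply Rmult_le_compat_r; [lra|]. apply Rmult_le_compat_l; [lra|apply Rmin_r].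
    - replace (2 * (eps / (4 * C ^ 2)) * C ^ 2) with (eps / 2) by (field; lra). lra. }
  destruct (pow_lt_1_zero (3 / 4) ltac:(rewrite Rabs_pos_eq; lra) eta (proj1 He)) as [n Hn].
  specialize (Hn n (le_n n)). rewrite Rabs_pos_eq in Hn by (apply pow_le; lra).
  destruct (INR_unbounded (2 / eta)) as [N0 HN0].
  (* [N0] forces [1 - kappa N <= eta / 2], and the maximum with [a] lets the same [N] bound the end
     blocks. *)
  set (N := Nat.max N0 a).
  assert (HN : 1 - kappa N ^ 2 <= eta).
  { assert (H0 : INR N0 <= INR N) by (apply le_INR; unfold N; lia).
    assert (H1 : 1 - kappa N = 1 / INR (S N)).
    { unfold kappa. rewrite S_INR. generalize (pos_INR N). intros. field. lra. }
    assert (H2 : 1 / INR (S N) <= eta / 2).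
    { rewrite S_INR. apply Rle_div_l; [generalize (pos_INR N); lra|].
      apply Rmult_le_reg_l with (2 / eta); [apply Rdiv_lt_0_compat; lra|].
      replace (2 / eta * (eta / 2 * (INR N + 1))) with (INR N + 1) by (field; lra). lra. }
    generalize (kappa_bounds N). nra. }
  (* [K_cross] needs [n * (2 * N + 2) + 1] letters, one fewer than cells; the surplus keeps the word
     longer than [a] and than one letter. *)
  exists (n * (2 * N + 2) + N + 5)%nat.
  (* A bound uniform in [x] and [y] and strictly below [eps], so that the supremum is strictly below
     [eps] too. *)
  intros lam _ Hn0 HF HL. exists (2 * eta * C ^ 2). split; [exact Hee|].
  intros x y Hx Hy.
  set (w := pattern lam).
  assert (Lw : length w = (comp_size lam - 1)%nat)
    by (unfold w, pattern, comp_size; now rewrite length_map, length_seq).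
  assert (Fw : (prefix_const_len w < a)%nat).
  { apply INR_lt. unfold first_run_len in HF. rewrite S_INR in HF. fold w in HF. lra. }
  assert (Fl : (prefix_const_len (rev w) < a)%nat).
  { apply INR_lt. unfold last_run_len in HL. rewrite S_INR in HL. fold w in HL. lra. }
  assert (HaN : (a <= N)%nat) by (unfold N; lia).
  destruct (densities lam ltac:(lia) x y Hx Hy) as [-> [-> ->]]. fold w.
  destruct (cross_integrated w (1 - eta)) with (x := x) (y := y) as [I1 I2]; auto; try lia.
  { lra. }
  { intros z z' Hz Hz'. apply K_cross with N n; auto; lia || lra. }
  apply normalized_gap_bound; auto; try lra.
  - apply RInt_nonneg; try lra. apply K_marginal_good; lia.
  - split; [apply RInt_nonneg; auto using K_good; lra|].
    apply first_marginal_bound; auto; lia.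
  - split; [apply RInt_nonneg; try lra; apply K_good_start; auto; lia|].
    apply last_marginal_bound; auto; lia.
Qed.
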